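(* Let $\Gamma$ be a finite simplicial graph with vertex set $V$ and let $L\subseteq V$ be its set of principal vertices. Suppose that every $u\in V\setminus L$ satisfies the following condition: all principal maximal $m$ with $m\geq_\circ u$ are in the same component of $\Gamma-lk(u)$. Then $M(V)=M(L)$.
   Context: **Graphs and RAAGs.** $\Gamma$ is a finite simplicial graph with vertex set $V$; $A_\Gamma$ is the right-angled Artin group with generating set $V$ and relations $[v,w]=1$ whenever $v,w$ are adjacent. For a vertex $v$, $lk(v)$ is the induced subgraph on the set of vertices adjacent to $v$, and $st(v)$ is the induced subgraph on $v$ together with the vertices adjacent to $v$ (both are identified with their vertex sets when convenient). $V^\pm=V\sqcup V^{-1}$ is the set of generators and their inverses; for a set $W$ of vertices, $W^\pm$ is the set of elements of $W$ and their inverses. For $m\in V^\pm$, $lk(m),st(m)$ denote the link and star of the underlying vertex. For $m,n\in V^\pm$, $[m,n]=1$ means that $m,n$ commute in $A_\Gamma$ (the underlying vertices are equal or adjacent). **Relations.** $v\le w$ means $lk(v)\subseteq st(w)$; $v\sim w$ means $v\le w$ and $w\le v$. The relation $\le$ induces a partial order on the equivalence classes $[v]$ of $\sim$. A vertex is maximal if its equivalence class is maximal in this partial order. $m\ge_\circ u$ (equivalently $u\le_\circ m$) means $lk(u)\subseteq lk(m)$. A vertex $v$ is principal if there is no vertex $w$ with $lk(v)$ strictly contained in $lk(w)$. All maximal vertices are principal, but a principal vertex need not be maximal. **$\Gamma$W-partitions.** For $m\in V^\pm$ consider the components $C$ of $\Gamma-lk(m)$. A subset $U\subset V^\pm$ is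 $m$-inseparable if either $C=\{u\}$ for some component $C$ and $U=\{u\}$ or $U=\{u^{-1}\}$ (this includes $u=m^{\pm1}$), or $U=C^\pm$ for a component $C$ with more than one vertex. $\mathbf I(m)$ is the collection of $m$-inseparable subsets. A $\Gamma$W-subset based at $m$ is a union $P$ of elements of $\mathbf I(m)$ with $m\in P$, $m^{-1}\notin P$; set $P^*=V^\pm\setminus lk(m)^\pm\setminus P$. The partition $\mathcal P=\{P\,|\,P^*\,|\,lk(m)^\pm\}$ of $V^\pm$ (unordered in $P,P^*$) is a $\Gamma$W-partition based at $m$ if $P$ is a $\Gamma$W-subset based at $m$ and both $P$ and $P^*$ have at least two elements; $P,P^*$ are its sides. It is then also based at $m^{-1}$, and we say it is based at the underlying vertex; a partition may be based at several vertices. **Compatibility.** $\Gamma$W-partitions $\mathcal P$ (based at $m$) and $\mathcal Q$ (based at $n$) are compatible if either (1) $P^\times\cap Q^\times=\emptyset$ for at least one choice of sides $P^\times\in\{P,P^*\}$, $Q^\times\in\{Q,Q^*\}$, or (2) $[m,n]=1$ and $st(m)\ne st(n)$. A compatible collection is a set of (distinct) pairwise compatible $\Gamma$W-partitions. For $U\subseteq V$, $M(U)$ is the largest possible size of a compatible collection of $\Gamma$W-partitions each of which is based at some $u\in U$.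
   Formalization: ''Maximal'' is taken as maximal for ≤ among the vertices m ≥_∘ u, not among all vertices; with absolute maximality the claim fails, e.g. for the cone over two disjoint edges and a point u, where M(V) ≥ 5 but M(L) = 4. *)

(* Defs.v *)
From mathcomp Require Import all_boot.

Set Implicit Arguments.
Unset Strict Implicit.
Unset Printing Implicit Defensive.

Record sgraph := SGraph {
  vertex :> finType;
  adj : rel vertex;
  adj_sym : symmetric adj;
  adj_irrefl : irreflexive adj }.

Section GammaWhitehead.
Variable G : sgraph.
Implicit Types (v w u : G) (W C : {set G}).

Definition lk v : {set G} := [set w | adj v w].
Definition st v : {set G} := v |: lk v.

(* The vertex sets of the connected components of Gamma - W. *)
Definition components W : {set {set G}} :=
  equivalence_partition
    (connect [rel x y : G | [&& x \notin W, y \notin W & adj x y]]) (~: W).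

Definition vle v w : bool := lk v \subset st w.
Definition vequiv v w : bool := vle v w && vle w v.
Definition lk_le u m : bool := lk u \subset lk m.

(* The class of v is maximal, for the order induced by <=, among the classes
   of the elements of W.  In the hypothesis on a non-principal vertex u,
   "maximal m with m >=_o u" is read as maximal among the vertices m >=_o u.
   Reading it as maximal among all vertices would make the theorem false:
   if Gamma is the cone over the disjoint union of two edges and a point u,
   the cone point is the only maximal vertex and is not >=_o u, so that the
   hypothesis would be void, whereas M(V) = 5 and M(L) = 4. *)
Definition maximal_in W v : bool :=
  (v \in W) && [forall w in W, vle v w ==> vequiv v w].

Definition principal v : bool := ~~ [exists w, lk v \proper lk w].

(* [(v, false)] is the generator v and [(v, true)] its inverse. *)
Definition letter : finType := (G * bool)%type.
Implicit Types (m n : letter) (P U : {set letter}).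

Definition inv m : letter := (m.1, ~~ m.2).
Definition pm W : {set letter} := [set m : letter | m.1 \in W].

Definition commute m n : bool := (m.1 == n.1) || adj m.1 n.1.

Definition inseparable m : {set {set letter}} :=
  [set U : {set letter} | [exists C in components (lk m.1),
     [exists u, (C == [set u]) &&
                ((U == [set (u, false)]) || (U == [set (u, true)]))]
     || (1 < #|C|) && (U == pm C)]].

Definition GW_subset m P : bool :=
  [&& [exists S : {set {set letter}}, (S \subset inseparable m) && (P == cover S)],
      m \in P & inv m \notin P].

Definition costar m P : {set letter} := ~: pm (lk m.1) :\: P.

(* {P | P^* | lk(m)^+-}: the unordered pair of sides, and the link part. *)
Definition partition3 : finType :=
  ({set {set letter}} * {set letter})%type.
Implicit Types (p q : partition3).

Definition sides p : {set {set letter}} := p.1.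

Definition based_at_letter m p : bool :=
  [exists P : {set letter},
    [&& GW_subset m P, 2 <= #|P|, 2 <= #|costar m P| &
        p == ([set P; costar m P], pm (lk m.1))]].

Definition based_at v p : bool := [exists b : bool, based_at_letter (v, b) p].

(* All bases of a partition have the same link, so the choice of the bases in
   the second clause is immaterial. *)
Definition compatible p q : bool :=
  [exists P in sides p, [exists Q in sides q, [disjoint P & Q]]] ||
  [exists m, [exists n, [&& based_at_letter m p, based_at_letter n q,
                            commute m n & st m.1 != st n.1]]].

Definition compatible_collection (S : {set partition3}) : bool :=
  [forall p in S, [forall q in S, (p != q) ==> compatible p q]].

Definition M W : nat :=
  \max_(S : {set partition3} | compatible_collection S &&
         [forall p in S, [exists u in W, based_at u p]]) #|S|.

End GammaWhitehead.

(* Main.v *)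
Require Import Defs.
From mathcomp Require Import all_boot.

(** Write K for lk(u).  A compatible collection Pi is turned into one of the
same size all of whose members are based at principal vertices by exchanging,
one at a time, a partition based only at non-principal vertices for one based
at a principal vertex.

Everything rests on a local description of sides ([GW_subsetP]): a set P of
letters is a GW-subset based at m exactly when it contains m and not its
inverse, avoids lk(m), and is closed under adjacency outside lk(m).  Hence a
GW-subset based at u that misses n and its inverse, where lk(u) is contained in
lk(n), automatically avoids lk(n) and is closed under adjacency outside lk(n),
and its union with a GW-subset based at n is again a GW-subset based at n.

Let u be non-principal, and let S be the set of principal vertices n with K
contained in lk(n).  Each n in S has a neighbour outside K, and the hypothesis
puts all of S in one component of Gamma - K, so every partition based at u has
S and its inverses inside a single side ([above_same_side]); let P be the other,
outer, side.  Among the outer sides occurring in Pi, with u varying, choose P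
with K maximal and then P itself maximal.  The new side is R = A + P1 where

- P1 is a proper part of P containing u and not crossing any member of Pi
  that lies inside P ([inner_part]).  A member of Pi that lies inside P and
  contains u must have link K: its link contains K because otherwise a common
  neighbour would connect u to S, so by maximality it is K, or else the base is
  in S, outside P.  The largest such member, or just u, is P1.

- A is the largest side occurring in Pi that is disjoint from P and based in S,
  or just an element of S ([enlarged_base]).  The maximality of P and of A
  forces every other member of Pi with a side T disjoint from P, unless it is
  compatible by commutation, to have T disjoint from A or from the opposite of
  A, and both survive the addition of P1 to A.

The base of A is in S, so R is based at a principal vertex.  By construction R
is compatible with every member of Pi except the partition of P.  With the
latter it crosses: all four corners are non-empty, since P1 is neither empty nor
all of P and R splits the base of A from its inverse.  So R is new, and replacing
the partition of P by that of R preserves the size of the collection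
([exchange]). *)

Set Implicit Arguments.
Unset Strict Implicit.
Unset Printing Implicit Defensive.

Local Notation inv := Defs.inv.
Local Notation commute := Defs.commute.

(** * Sides, links and adjacency *)

Lemma exists_maximizer (I : finType) (A : pred I) (f : I -> nat) i0 :
  A i0 -> exists2 i, A i & forall j, A j -> f j <= f i.
Proof. by move=> Ai0; case: (arg_maxnP f Ai0) => i; exists i. Qed.

Section Sides.
Variable G : sgraph.
Implicit Types (u v w a b : G) (m n t x y : letter G).
Implicit Types (P Q T : {set letter G}) (p q : partition3 G).

Lemma invK : involutive (@inv G).
Proof. by case=> a e; rewrite /inv /= negbK. Qed.

Lemma same_vertex x y : x.1 = y.1 -> y = x \/ y = inv x.
Proof.
case: x y => [a e] [b f] /= <-; rewrite /inv /=.
by case: e f => [] []; [left | right | right | left].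
Qed.

Lemma in_costar m P x : (x \in costar m P) = (x \notin P) && (x.1 \notin lk m.1).
Proof. by rewrite !inE. Qed.

Lemma mem_lkC u v : (u \in lk v) = (v \in lk u).
Proof. by rewrite !inE adj_sym. Qed.

Lemma lk_irrefl v : v \notin lk v.
Proof. by rewrite inE adj_irrefl. Qed.

Lemma connect_outsideC (K : {set G}) :
  connect_sym [rel a b : G | [&& a \notin K, b \notin K & adj a b]].
Proof. by apply: sym_connect_sym => a b /=; rewrite adj_sym andbCA. Qed.

Definition adj_closed (K : {set G}) P :=
  forall x y, x \in P -> x.1 \notin K -> y.1 \notin K -> adj x.1 y.1 -> y \in P.

(** Closure under adjacency ignores signs, so going along an edge and back
identifies a letter with its inverse: a component with several vertices lies
entirely inside P, with both signs, as soon as one of its letters does. *)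
Lemma adj_closed_component (K : {set G}) P x y :
  adj_closed K P -> x \in P -> x.1 != y.1 ->
  connect [rel a b : G | [&& a \notin K, b \notin K & adj a b]] x.1 y.1 ->
  forall z, (z.1 = x.1) \/ (z.1 = y.1) -> z \in P.
Proof.
move=> cl xP nxy; set e := rel_of_simpl _ => cxy.
pose Z := [pred a : G | ((a, true) \in P) && ((a, false) \in P)].
have stepZ s b : s \in P -> e s.1 b -> b \in Z.
  by move=> sP /and3P[sK bK sb]; apply/andP; split; apply: (cl s).
have ZP z : z.1 \in Z -> z \in P by case: z => a [] /andP[].
have clZ : closed e Z.
  apply: (intro_closed (connect_outsideC K)) => a b ab aZ.
  by apply: (stepZ (a, true)) => //; apply: ZP.
have yZ : y.1 \in Z.
  case/connectP: (cxy) => -[|b s] /= => [_ yx|/andP[xb bs] ->].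
    by rewrite yx eqxx in nxy.
  rewrite -(closed_connect clZ (x := b)); first exact: stepZ xb.
  by apply/connectP; exists s.
by move=> z [] zE; apply: ZP; rewrite zE ?(closed_connect clZ cxy).
Qed.

(** The components are traded for a condition on single edges: singleton
components impose nothing, and on the others the closure under adjacency
produces whole components with both signs. *)
Lemma GW_subsetP m P :
  reflect [/\ m \in P, inv m \notin P,
              forall x, x \in P -> x.1 \notin lk m.1
            & adj_closed (lk m.1) P]
          (GW_subset m P).
Proof.
set K := lk m.1.
apply: (iffP and3P) => [[/existsP[S /andP[/subsetP SI /eqP PS]] mP imP]|
                        [mP imP avP clP]].
  have avP x : x \in P -> x.1 \notin K.
    rewrite PS => /bigcupP[U /SI]; rewrite inE => /existsP[C /andP[]].
    case/imsetP => c; rewrite inE => cK ->.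
    case/orP => [/existsP[v /andP[/eqP CE UE]]|/andP[_ /eqP->]].
      have: v \in [set v] by rewrite inE.
      rewrite -CE !inE => /andP[vK _].
      by case/orP: UE => /eqP->; rewrite inE => /eqP->.
    by rewrite !inE => /andP[].
  split=> // x y; rewrite PS => /bigcupP[U US xU] xK yK xy.
  apply/bigcupP; exists U => //.
  move: (SI _ US); rewrite inE => /existsP[C /andP[CC]].
  have Cxy : x.1 \in C -> y.1 \in C.
    case/imsetP: CC => c; rewrite inE => cK ->.
    rewrite !inE in xK yK *; case/andP => _ cx; rewrite yK.
    by apply: connect_trans cx (connect1 _); rewrite /= !inE xK yK.
  case/orP => [/existsP[v /andP[/eqP CE UE]]|/andP[_ /eqP UE]].
    have xv : x.1 = v by case/orP: UE xU => /eqP->; rewrite inE => /eqP->.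
    move: Cxy; rewrite xv CE inE eqxx => /(_ isT); rewrite inE => /eqP yv.
    by rewrite xv yv adj_irrefl in xy.
  by move: xU; rewrite UE !inE; apply: Cxy.
split=> //; apply/existsP.
exists [set U in inseparable m | U \subset P]; apply/andP; split.
  by apply/subsetP => U; rewrite inE => /andP[].
rewrite eqEsubset; apply/andP; split; last first.
  by apply/bigcupsP => U; rewrite inE => /andP[].
apply/subsetP => x xP; have xK := avP _ xP.
set e := [rel a b : G | [&& a \notin K, b \notin K & adj a b]].
pose C := [set b in ~: K | connect e x.1 b].
have CC : C \in components K by apply/imsetP; exists x.1; rewrite // inE.
have xC : x.1 \in C by rewrite !inE; rewrite inE in xK; rewrite xK connect0.
have [/cards1P[v Cv]|C1] := boolP (#|C| == 1).
  have xv : x.1 = v by move: xC; rewrite Cv inE => /eqP.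
  apply/bigcupP; exists [set x]; rewrite ?inE //.
  rewrite sub1set xP andbT; apply/existsP; exists C; rewrite CC /=.
  apply/orP; left; apply/existsP; exists v; rewrite Cv eqxx -xv /=.
  by case: (x) => a []; rewrite eqxx ?orbT.
have C2 : 1 < #|C|.
  by rewrite ltn_neqAle eq_sym C1; apply/card_gt0P; exists x.1.
have /subsetPn[z zC] : ~~ (C \subset [set x.1]).
  by apply: contraL C2 => /subset_leq_card; rewrite cards1 -leqNgt.
rewrite inE => zx.
apply/bigcupP; exists (pm C); last by rewrite inE.
rewrite !inE; apply/andP; split.
  by apply/existsP; exists C; rewrite CC C2 eqxx orbT.
apply/subsetP => y; rewrite inE => yC.
have [yx|nyx] := eqVneq y.1 x.1.
  apply: (adj_closed_component (x := x) (y := (z, true)) clP) => //=.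
  - by rewrite eq_sym.
  - by move: zC; rewrite inE => /andP[].
  by left.
apply: (adj_closed_component (x := x) (y := y) clP) => //.
- by rewrite eq_sym.
- by move: yC; rewrite inE => /andP[].
by right.
Qed.

Definition GW_side m P :=
  [&& GW_subset m P, 2 <= #|P| & 2 <= #|costar m P|].
Definition partition_of m P : partition3 G :=
  ([set P; costar m P], pm (lk m.1)).

Lemma based_at_letterP m p :
  reflect (exists2 P, GW_side m P & p = partition_of m P) (based_at_letter m p).
Proof.
apply: (iffP existsP) => [[P /and4P[h1 h2 h3 /eqP->]]|[P /and3P[h1 h2 h3] ->]].
  by exists P => //; apply/and3P.
by exists P; apply/and4P.
Qed.

Lemma based_atP v p :
  reflect (exists2 m, m.1 = v & exists2 P, GW_side m P & p = partition_of m P)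
          (based_at v p).
Proof.
apply: (iffP existsP) => [[e /based_at_letterP h]|[[a e] /= <-]].
  by exists (v, e).
by exists e; apply/based_at_letterP.
Qed.

Section SideFacts.
Variables (m : letter G) (P : {set letter G}).
Hypothesis sideP : GW_side m P.

Let axP := elimT (GW_subsetP m P) (proj1 (andP sideP)).

Lemma side_base : m \in P. Proof. by case: axP. Qed.
Lemma side_inv : inv m \notin P. Proof. by case: axP. Qed.
Lemma side_lk x : x \in P -> x.1 \notin lk m.1.
Proof. by case: axP => _ _ h _; apply: h. Qed.
Lemma side_closed x y :
  x \in P -> y.1 \notin lk m.1 -> adj x.1 y.1 -> y \in P.
Proof. by move=> xP; case: axP => _ _ h1 h2; apply: h2 => //; apply: h1. Qed.

Lemma costarK : costar (inv m) (costar m P) = P.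
Proof.
apply/setP => x; rewrite !in_costar /= negb_and !negbK.
by case: (boolP (x \in P)) => [/side_lk->|]; rewrite ?andbN.
Qed.

Lemma side_inv_costar : inv m \in costar m P.
Proof. by rewrite in_costar side_inv lk_irrefl. Qed.

Lemma side_costar : GW_side (inv m) (costar m P).
Proof.
have [h1 h2 h3] := and3P sideP.
rewrite /GW_side h3 costarK h2 !andbT; apply/GW_subsetP.
rewrite side_inv_costar invK in_costar side_base; split=> //.
  by move=> x; rewrite in_costar => /andP[].
move=> x y; rewrite !in_costar /= => /andP[xP xK] _ yK xy; rewrite yK andbT.
by apply: contra xP => yP; apply: (side_closed yP); rewrite // adj_sym.
Qed.

Lemma partition_costar : partition_of (inv m) (costar m P) = partition_of m P.
Proof. by rewrite /partition_of costarK setUC. Qed.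

End SideFacts.

Lemma partition_of_lk m n P Q :
  partition_of m P = partition_of n Q -> lk m.1 = lk n.1.
Proof.
by case=> _ /setP h; apply/setP => a; move: (h (a, true)); rewrite !inE.
Qed.

Lemma partition_of_side m n P Q :
  partition_of m P = partition_of n Q -> P = Q \/ P = costar n Q.
Proof.
case=> /setP/(_ P); rewrite set21 => /esym/set2P h _.
exact: h.
Qed.

Lemma compatible_sym : symmetric (@compatible G).
Proof.
move=> p q; apply: (f_equal2 orb).
  apply/exists_inP/exists_inP => -[P Pp /exists_inP[Q Qq PQ]]; exists Q => //;
    by apply/exists_inP; exists P; rewrite // disjoint_sym.
have commC m n : commute m n = commute n m by rewrite /commute eq_sym adj_sym.
by apply/existsP/existsP => -[m /existsP[n /and4P[h1 h2 h3 h4]]];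
  exists n; apply/existsP; exists m; rewrite h1 h2 commC h3 eq_sym h4.
Qed.

(** * Compatibility in terms of chosen bases *)

Definition orthogonal v w := adj v w && (st v != st w).

Definition nested m P n Q :=
  [|| [disjoint P & Q], [disjoint P & costar n Q],
      [disjoint costar m P & Q] | [disjoint costar m P & costar n Q]].

Lemma adj_same_lk v v' w w' :
  lk v = lk v' -> lk w = lk w' -> adj v w -> adj v' w'.
Proof.
move=> vv' ww' vw.
have : w \in lk v' by rewrite -vv' inE.
by rewrite mem_lkC ww' mem_lkC inE.
Qed.

Lemma compatible_orthogonal m P n Q :
  GW_side m P -> GW_side n Q -> orthogonal m.1 n.1 ->
  compatible (partition_of m P) (partition_of n Q).
Proof.
move=> sP sQ /andP[mn st_mn]; apply/orP; right.
apply/existsP; exists m; apply/existsP; exists n.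
rewrite /commute mn orbT st_mn !andbT.
by apply/andP; split; apply/based_at_letterP; [exists P | exists Q].
Qed.

(** The second clause of compatibility quantifies over all bases of the two
partitions; since the bases of a partition share their link, it can be tested
on the given ones. *)
Lemma compatible_nested m P n Q :
  GW_side m P -> GW_side n Q ->
  compatible (partition_of m P) (partition_of n Q) =
  orthogonal m.1 n.1 || nested m P n Q.
Proof.
move=> sP sQ; apply/idP/idP => [/orP[]|/orP[]]; last 1 first.
- move=> h; apply/orP; left.
  have h' X Y : X \in [set P; costar m P] -> Y \in [set Q; costar n Q] ->
      [disjoint X & Y] ->
    [exists P0 in sides (partition_of m P),
      exists Q0 in sides (partition_of n Q), [disjoint P0 & Q0]].
    move=> hX hY d; apply/exists_inP; exists X => //.
    by apply/exists_inP; exists Y.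
  by case/or4P: h => d; apply: h' d; rewrite !inE eqxx ?orbT.
- case/exists_inP => X /set2P hX /exists_inP[Y /set2P hY d].
  apply/orP; right; rewrite /nested.
  by case: hX hY d => -> [] -> ->; rewrite ?orbT.
- case/existsP => m' /existsP[n'].
  case/and4P => /based_at_letterP[P' _ /partition_of_lk mm'].
  case/based_at_letterP => Q' _ /partition_of_lk nn' c stmn.
  have mn' : adj m'.1 n'.1.
    by case/orP: c => // /eqP mn'; rewrite mn' eqxx in stmn.
  have mn : adj m.1 n.1 by exact: adj_same_lk mn'.
  rewrite /orthogonal mn /= orbC; apply/orP; right.
  apply: contra stmn => /eqP stE.
  (* Adjacent vertices with equal stars are the only vertices with their
     respective links, so the bases m' and n' are m and n. *)
  have nn : n'.1 = n.1.
    have: n'.1 \in st n.1 by rewrite -stE !inE (adj_same_lk (esym mm') erefl mn') ?orbT.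
    case/setU1P => //; rewrite nn' => h.
    by move: (lk_irrefl n'.1); rewrite h.
  have mm : m'.1 = m.1.
    have: m'.1 \in st m.1.
      by rewrite stE !inE adj_sym (adj_same_lk erefl (esym nn') mn') ?orbT.
    case/setU1P => //; rewrite mm' => h.
    by move: (lk_irrefl m'.1); rewrite h.
  by rewrite nn mm stE.
exact: compatible_orthogonal.
Qed.

(** A letter of P in lk(n) would be adjacent to n outside lk(m), which would
pull n into P, although n is in Q. *)
Lemma disjoint_sub_costar m P n Q :
  GW_side m P -> GW_side n Q -> n.1 \notin lk m.1 -> [disjoint P & Q] ->
  P \subset costar n Q.
Proof.
move=> sP sQ nm d; apply/subsetP => x xP.
rewrite in_costar (disjointFr d xP) /=; apply/negP => xn.
have: n \in P by apply: (side_closed sP xP nm); rewrite adj_sym; rewrite inE in xn.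
by move/(disjointFr d); rewrite side_base.
Qed.

(** A vertex of only one of the links is adjacent to a base, hence lies in P by
closure for the other base, but P avoids the link of each of its bases. *)
Lemma same_side_same_lk m n P :
  GW_side m P -> GW_side n P -> lk m.1 = lk n.1.
Proof.
suff h m' n' : GW_side m' P -> GW_side n' P -> lk m'.1 \subset lk n'.1.
  by move=> sm sn; apply/eqP; rewrite eqEsubset !h.
move=> sm sn; apply/subsetP => a am; apply/negPn/negP => an.
have: (a, true) \in P.
  by apply: (side_closed sn (side_base sm)); rewrite /= ?an //; rewrite inE in am.
by move/(side_lk sm); rewrite am.
Qed.

End Sides.

(** * Principal vertices above a given vertex *)

Section PrincipalVertices.
Variable G : sgraph.
Implicit Types (u v w a b : G) (m n t x y : letter G) (P T : {set letter G}).

Definition above u w := principal w && (lk u \subset lk w).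

Lemma principal_lk_max w v : principal w -> lk w \subset lk v -> lk v = lk w.
Proof.
move=> /existsPn/(_ v) pw wv; apply/eqP; rewrite eq_sym eqEsubset wv.
by rewrite properE wv /= negbK in pw.
Qed.

Lemma above_exists u : exists w, above u w.
Proof.
have [w uw wmax] := @exists_maximizer _ (fun w => lk u \subset lk w)
  (fun w => #|lk w|) u (subxx _); exists w.
rewrite /above uw andbT; apply/existsPn => v; apply/negP => wv.
have := proper_card wv; rewrite ltnNge wmax //.
exact: subset_trans uw (proper_sub wv).
Qed.

Lemma above_notin_lk u w : lk u \subset lk w -> w \notin lk u.
Proof. by move=> /subsetP uw; apply/negP => /uw; apply/negP/lk_irrefl. Qed.

Lemma above_neighbor_outside u w :
  ~~ principal u -> above u w -> exists2 y, adj w y & y \notin lk u.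
Proof.
move=> npu /andP[pw uw].
have /subsetPn[y yw yu] : ~~ (lk w \subset lk u).
  apply: contra npu => wu; apply/existsPn => v; rewrite (principal_lk_max pw wu).
  by move/existsPn: pw.
by exists y; rewrite // inE in yw.
Qed.

Lemma principal_eq_lk u w : lk u = lk w -> principal u = principal w.
Proof. by rewrite /principal => ->. Qed.

(** A vertex whose link strictly contains lk(v) would be adjacent to w, hence
lie in st(w) = st(v), next to v or equal to it, which is absurd. *)
Lemma principal_twin v w :
  adj v w -> st v = st w -> principal w -> principal v.
Proof.
move=> vw stE pw; apply/existsPn => a; apply/negP => /properP[/subsetP va [x xa xv]].
have: w \in lk a by apply: va; rewrite inE.
rewrite mem_lkC => wa.
have: a \in st v by rewrite stE; apply/setU1P; right.
case/setU1P => [av|/va]; first by rewrite av in xa; rewrite xa in xv.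
exact/negP/lk_irrefl.
Qed.

(** If lk(w) strictly contained lk(v), maximality would give lk(w) inside st(v),
so w would be adjacent to v, hence to itself. *)
Lemma maximal_principal u v : maximal_in [set x | lk_le u x] v -> principal v.
Proof.
case/andP; rewrite inE => uv /forall_inP vmax.
apply/existsPn => w; apply/negP => /properP[/subsetP vw [y yw yv]].
have := vmax w; rewrite inE /lk_le (subset_trans uv) => [|]; last exact/subsetP.
move=> /(_ isT)/implyP; rewrite /vequiv /vle => h.
have: lk v \subset st w by apply/subsetP => x /vw xw; apply/setU1P; right.
move/h => /andP[_ /subsetP wv].
have /wv := yw; case/setU1P => [yE|]; last exact/negP.
have /vw : w \in lk v by rewrite mem_lkC -yE.
exact/negP/lk_irrefl.
Qed.

Lemma maximal_in_above u w :
  lk_le u w -> exists2 v, maximal_in [set x | lk_le u x] v & vle w v.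
Proof.
move=> uw.
have vle_trans a b c : vle a b -> vle b c -> vle a c.
  move=> /subsetP ab /subsetP bc; apply/subsetP => x xa.
  have /setU1P[xb|/bc//] := ab _ xa.
  (* Here x = b is adjacent to a, so a lies in lk b, hence in st c. *)
  have /bc/setU1P[ac|] : a \in lk b by rewrite mem_lkC -xb.
    have : c \in lk b by rewrite -ac mem_lkC -xb.
    by rewrite mem_lkC -xb => xc; apply/setU1P; right.
  rewrite mem_lkC => ca.
  have /setU1P[cb|cb] := ab _ ca; first by rewrite xb cb setU11.
  by rewrite xb; apply/setU1P; right; rewrite mem_lkC.
pose f a := #|[set b | vle b a]|.
have ww : lk_le u w && vle w w.
  by rewrite uw; apply/subsetP => x xw; apply/setU1P; right.
have [m /andP[um wm] mmax] :=
  @exists_maximizer _ (fun v => lk_le u v && vle w v) f w ww; exists m => //.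
rewrite /maximal_in inE um; apply/forall_inP => v; rewrite inE => uv.
apply/implyP => mv; rewrite /vequiv mv /=.
have mvS : [set b | vle b m] \subset [set b | vle b v].
  by apply/subsetP => b; rewrite !inE => bm; apply: vle_trans mv.
have /eqP/setP/(_ v) : [set b | vle b m] == [set b | vle b v].
  by rewrite eqEcard mvS; apply: mmax; rewrite uv (vle_trans _ _ _ wm).
by rewrite !inE => ->; apply/subsetP => x xw; apply/setU1P; right.
Qed.

Section OneComponent.
Hypothesis same_component : forall u : G, ~~ principal u ->
     exists2 C : {set G}, C \in components (lk u) &
       forall m : G, principal m -> maximal_in [set x | lk_le u x] m ->
         m \in C.

(** The hypothesis only concerns the maximal vertices v above u.  Any principal w
above u is dominated by such a v, and a neighbour y of w outside lk(u) is equal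
or adjacent to v, so that w - y - v is a path in Gamma - lk(u). *)
Lemma above_connected u w w' :
  ~~ principal u -> above u w -> above u w' ->
  connect [rel a b : G | [&& a \notin lk u, b \notin lk u & adj a b]] w w'.
Proof.
move=> npu; set e := rel_of_simpl _; have eC := connect_outsideC (lk u).
have [C /imsetP[c _ CE] Cm] := same_component npu.
suff cw v : above u v -> connect e c v.
  by move=> uw uw'; apply: connect_trans (cw _ uw'); rewrite eC cw.
move=> uv; have [y vy yu] := above_neighbor_outside npu uv.
have [_ uv'] := andP uv.
have [m mm vm] := maximal_in_above uv'.
have := Cm m (maximal_principal mm) mm; rewrite CE inE => /andP[_ cm].
apply: connect_trans cm _; rewrite eC.
have vu := above_notin_lk uv'.
have mu : m \notin lk u.
  by apply: above_notin_lk; case/andP: mm; rewrite inE.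
have vy1 : e v y by apply/and3P.
have /(subsetP vm)/setU1P[<-|] : y \in lk v by rewrite inE.
  exact: connect1.
rewrite inE => my; apply: connect_trans (connect1 vy1) (connect1 _).
by apply/and3P; split; rewrite // adj_sym.
Qed.

(** For two letters at the same vertex, a neighbour of that vertex outside lk(m)
identifies the two signs. *)
Lemma above_same_side m P x y :
  GW_side m P -> ~~ principal m.1 -> above m.1 x.1 -> above m.1 y.1 ->
  x \in P -> y \in P.
Proof.
move=> sP npm ax ay xP; have [xy|nxy] := eqVneq x.1 y.1.
  have [b xb bm] := above_neighbor_outside npm ax.
  have bP : (b, true) \in P by apply: (side_closed sP xP).
  apply: (side_closed sP bP); rewrite -xy; first exact: (side_lk sP).
  by rewrite adj_sym.
apply: (adj_closed_component _ xP nxy (above_connected npm ax ay)); last by right.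
by move=> s t sP' _; apply: (side_closed sP).
Qed.

(** * Exchanging one partition *)

Section Exchange.
Variable Pi : {set partition3 G}.
Hypothesis Pi_compatible : compatible_collection Pi.

Definition side_of m P := GW_side m P && (partition_of m P \in Pi).

(** By [above_same_side], one of the two sides of a partition based at a
non-principal vertex misses all the principal vertices above it; this is the
side of which pieces can be moved to a base above. *)
Definition outer_side m P :=
  [&& side_of m P, ~~ principal m.1 & [forall x, above m.1 x.1 ==> (x \notin P)]].

Lemma side_of_costar m P : side_of m P -> side_of (inv m) (costar m P).
Proof.
by case/andP => sP pPi; rewrite /side_of side_costar // partition_costar.
Qed.

Lemma outer_side_or m P : side_of m P -> ~~ principal m.1 ->
  outer_side m P \/ outer_side (inv m) (costar m P).
Proof.
move=> sPi npm; have [sP _] := andP sPi.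
have [h|/forallPn[x]] := boolP [forall x, above m.1 x.1 ==> (x \notin P)].
  by left; apply/and3P.
rewrite negb_imply negbK => /andP[ax xP]; right.
apply/and3P; split; rewrite ?side_of_costar //; apply/forallP => y.
by apply/implyP => ay; rewrite in_costar (above_same_side sP npm ax ay xP).
Qed.

Lemma side_of_nested m P n Q : side_of m P -> side_of n Q ->
  partition_of m P != partition_of n Q -> ~~ orthogonal m.1 n.1 -> nested m P n Q.
Proof.
move=> /andP[sP pPi] /andP[sQ qPi] npq /negbTE no.
have := Pi_compatible => /forall_inP/(_ _ pPi)/forall_inP/(_ _ qPi)/implyP/(_ npq).
by rewrite (compatible_nested sP sQ) no.
Qed.

Variables (m : letter G) (P : {set letter G}).
Hypothesis P_outer : outer_side m P.
Hypothesis P_max : forall t T, outer_side t T -> lk m.1 \subset lk t.1 ->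
  lk t.1 = lk m.1 /\ #|T| <= #|P|.

Local Notation u := m.1.
Local Notation K := (lk m.1).
Local Notation p := (partition_of m P).

Let P_of : side_of m P := proj1 (andP P_outer).
Let sP : GW_side m P := proj1 (andP P_of).
Let npu : ~~ principal u. Proof. by case/and3P: P_outer. Qed.

Lemma above_notin_outer n : above u n.1 -> n \notin P.
Proof. by case/and3P: P_outer => _ _ /forallP/(_ n)/implyP. Qed.

(** A letter of P adjacent to n would lie outside lk(m), and the closure of P
under adjacency would then put n in P. *)
Lemma outer_notin_lk n x : above u n.1 -> x \in P -> x.1 \notin lk n.1.
Proof.
move=> an xP; apply: contra (above_notin_outer an) => xn.
apply: (side_closed sP xP); rewrite // ?above_notin_lk //; first by case/andP: an.
by rewrite adj_sym; rewrite inE in xn.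
Qed.

Lemma base_notin_lk t : t.1 \notin K -> u \notin lk t.1.
Proof. by rewrite mem_lkC. Qed.

Lemma not_orthogonal_to_base t : t.1 \notin K -> ~~ orthogonal u t.1.
Proof. by apply: contra => /andP[ut _]; rewrite inE. Qed.

(** A vertex y of lk(m) outside lk(t) is a common neighbour of m and n, so T
cannot separate m from n. *)
Lemma lk_le_of_split t T n :
  side_of t T -> t.1 \notin K -> above u n.1 -> n.1 \notin lk t.1 ->
  (n \in T) != (m \in T) -> K \subset lk t.1.
Proof.
move=> /andP[sT _] tK /andP[_ /subsetP un] nt split_nm.
apply/subsetP => y yK; apply/negPn/negP => yt.
have ut := base_notin_lk tK.
have join x z : x.1 \notin lk t.1 -> z.1 \notin lk t.1 ->
    adj x.1 y -> adj z.1 y -> x \in T -> z \in T.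
  move=> xt zt xy zy xT.
  have yT : (y, true) \in T by apply: (side_closed sT xT).
  by apply: (side_closed sT yT); rewrite // adj_sym.
have my : adj u y by rewrite inE in yK.
have ny : adj n.1 y by have := un _ yK; rewrite inE.
case/negP: split_nm; apply/eqP.
by apply/idP/idP; apply: join.
Qed.

(** Here T separates n from m, so lk(t) contains lk(m).  If t were not principal,
maximality of lk(m) would give equality; then the side opposite to T would be
an outer side containing P, hence equal to P by maximality, and T would be a
side of the partition of P. *)
Lemma disjoint_above_principal t T n :
  side_of t T -> partition_of t T != p -> t.1 \notin K -> [disjoint T & P] ->
  above u n.1 -> n \in T -> above u t.1.
Proof.
move=> T_of neqp tK dTP an nT; have [sT _] := andP T_of.
have mT : m \notin T by rewrite (disjointFl dTP) ?side_base.
have nt := side_lk sT nT.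
have Kt : K \subset lk t.1.
  by apply: (lk_le_of_split T_of tK an nt); rewrite nT (negbTE mT).
rewrite /above Kt andbT; have [//|npt] := boolP (principal t.1).
have lkE : lk t.1 = K by case: (outer_side_or T_of npt) => h; case: (P_max h).
have [/and3P[_ _ /forallP/(_ n)]|h] := outer_side_or T_of npt.
  rewrite nT implybF /above lkE; by rewrite -[_ && _]/(above u n.1) an.
have [_ le_card] := P_max h Kt.
have PT : P \subset costar t T.
  by apply: disjoint_sub_costar sP sT tK _; rewrite disjoint_sym.
have PE : P = costar t T by apply/eqP; rewrite eqEcard PT.
case/negP: neqp; apply/eqP.
by rewrite -(partition_costar sT) -PE /partition_of /costar /= lkE.
Qed.

(** A is a largest side of the collection disjoint from P and based above m, or a
single letter when there is none.  A side T disjoint from P that meets A and the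
opposite of A would contain A, up to the bases, and be based above m; since it
is not larger than A it would agree with A up to the bases, and so not meet the
opposite of A.  A is only claimed to be a GW-subset, since a single letter is
too small to be a side. *)
Lemma enlarged_base :
  exists n A, [/\ above u n.1, GW_subset n A, [disjoint A & P] &
    forall t T, side_of t T -> partition_of t T != p -> t.1 \notin K ->
      ~~ orthogonal t.1 n.1 -> [disjoint T & P] ->
      [disjoint T & A] || [disjoint T & costar n A]].
Proof.
pose F (nA : letter G * {set letter G}) :=
  [&& side_of nA.1 nA.2, above u nA.1.1 & [disjoint nA.2 & P]].
have [[[n0 A0] /= F0]|noF] := altP (@existsP _ F); last first.
  have [w uw] := above_exists u.
  exists (w, false), [set (w, false)]; split=> //.
  - apply/GW_subsetP; rewrite !inE; split=> // [|x|x y]; first by apply/eqP.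
      by rewrite inE => /eqP->; apply: lk_irrefl.
    by rewrite !inE => /eqP-> /= _ wy wy'; rewrite wy' in wy.
  - by rewrite disjoints1 above_notin_outer.
  move=> t T T_of neqp tK _ dTP; rewrite disjoint_sym disjoints1.
  have [wT|//] := boolP (_ \in T).
  case/existsPn/(_ (t, T))/negP: noF; apply/and3P; split=> //=.
  exact: (disjoint_above_principal (n := (w, false)) T_of neqp tK dTP uw wT).
have [[n A] /and3P[/= A_of an dAP] Amax] :=
  @exists_maximizer _ F (fun nA => #|nA.2|) _ F0.
have [sA _] := andP A_of.
exists n, A; split=> //; first by case/and3P: sA.
move=> t T T_of neqp tK noT dTP; have [sT _] := andP T_of.
have inF : above u t.1 -> #|T| <= #|A|.
  by move=> ut; apply: (Amax (t, T)); apply/and3P.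
have [/partition_of_side[->|->]|neqA] :=
    eqVneq (partition_of t T) (partition_of n A).
- by rewrite orbC disjoints_subset; apply/orP; left; apply/subsetP=> x;
    rewrite !inE => ->.
- by apply/orP; left; rewrite disjoints_subset; apply/subsetP => x; rewrite !inE => /andP[].
have mP := side_base sP.
have nK : n.1 \notin K by apply: above_notin_lk; case/andP: an.
have mT : m \in costar t T.
  apply: (subsetP (disjoint_sub_costar sP sT tK _)) => //.
  by rewrite disjoint_sym.
have mA : m \in costar n A.
  apply: (subsetP (disjoint_sub_costar sP sA nK _)) => //.
  by rewrite disjoint_sym.
case/or4P: (side_of_nested T_of A_of neqA noT) => [->//|->|dTA|dTA].
- by rewrite orbT.
- apply/orP; right; have nA := side_base sA.
  have nTc : n \notin costar t T by rewrite (disjointFl dTA).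
  have [nT|nT] := boolP (n \in T).
    have leTA := inF (disjoint_above_principal T_of neqp tK dTP an nT).
    have AT : A \subset T.
      rewrite -(costarK sT); apply: disjoint_sub_costar sA (side_costar sT) _ _.
        by rewrite /= mem_lkC (side_lk sT).
      by rewrite disjoint_sym.
    have -> : T = A by apply/eqP; rewrite eq_sym eqEcard AT.
    rewrite disjoints_subset; apply/subsetP=> x.
    by rewrite !inE => ->.
  (* Otherwise t and n are adjacent with the same star, and T and A agree away from their
     bases. *)
  move: nTc; rewrite in_costar nT /= negbK => nt.
  have tn : adj t.1 n.1 by rewrite inE in nt.
  have stE : st t.1 = st n.1 by move: noT; rewrite /orthogonal tn negbK => /eqP.
  have aut : above u t.1.
    case/andP: an => pn /subsetP un; rewrite /above (principal_twin tn) //=.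
    apply/subsetP => x xK; have /setU1P[xt|//] : x \in st t.1.
      by rewrite stE; apply/setU1P; right; apply: un.
    by rewrite -xt xK in tK.
  have AT : A :\ n \subset T :\ t.
    apply/subsetP => x /setD1P[xn xA]; have xlk := side_lk sA xA.
    apply/setD1P; split.
      by apply: contra xlk => /eqP->; rewrite inE adj_sym.
    have := disjointFl dTA xA; rewrite in_costar => /negbT.
    rewrite negb_and !negbK => /orP[//|xt].
    have /setU1P[xn1|xlk'] : x.1 \in st n.1 by rewrite -stE; apply/setU1P; right.
      case: (same_vertex (esym xn1)) => xE; first by rewrite xE eqxx in xn.
      by case/negP: (side_inv sA); rewrite -xE.
    by rewrite xlk' in xlk.
  have TA : T :\ t = A :\ n.
    apply/esym/eqP; rewrite eqEcard AT.
    have := inF aut; rewrite (cardsD1 t T) (cardsD1 n A) nA.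
    by rewrite (side_base sT) leq_add2l.
  rewrite disjoints_subset; apply/subsetP => x xT.
  rewrite in_setC in_costar negb_and !negbK.
  have [->|xt] := eqVneq x t; first by rewrite mem_lkC nt orbT.
  have : x \in A :\ n by rewrite -TA; apply/setD1P.
  by case/setD1P => _ ->.
- by have := disjointFr dTA mT; rewrite mA.
Qed.

(** P1 is a largest side of the collection that contains m and is properly
inside P, or [set m] if there is none.  Its link is lk(m), so it is orthogonal
to none of the sides T inside P.  The opposites of two sides inside P have a
letter in common, so T and P1 are disjoint or comparable. *)
Lemma inner_part :
  exists P1 : {set letter G}, [/\ m \in P1, P1 \proper P, adj_closed K P1 &
    forall t T, side_of t T -> t.1 \notin K -> T \proper P ->
      (T \subset P1) || [disjoint T & P1]].
Proof.
have [n an] : exists n : letter G, above u n.1.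
  by have [w uw] := above_exists u; exists (w, true).
have nK : n.1 \notin K by apply: above_notin_lk; case/andP: an.
have nP := above_notin_outer an.
have mP := side_base sP.
(* The letter n is common to the opposites of all the sides inside P. *)
have n_costar t T : side_of t T -> T \proper P -> n \in costar t T.
  move=> /andP[sT _] TP; rewrite in_costar (contra (subsetP (proper_sub TP) n)) //=.
  rewrite mem_lkC; apply: outer_notin_lk => //.
  by apply: (subsetP (proper_sub TP)); apply: side_base sT.
have lkE t T : side_of t T -> t.1 \notin K -> T \proper P -> m \in T -> lk t.1 = K.
  move=> T_of tK TP mT; have [sT _] := andP T_of.
  have := n_costar _ _ T_of TP; rewrite in_costar => /andP[nT nt].
  have Kt : K \subset lk t.1.
    by apply: (lk_le_of_split T_of tK an nt); rewrite mT (negbTE nT).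
  have [pt|npt] := boolP (principal t.1); last first.
    by case: (outer_side_or T_of npt) => h; case: (P_max h).
  have/above_notin_outer/negP[] : above u t.1 by rewrite /above pt.
  by apply: (subsetP (proper_sub TP)); apply: side_base sT.
pose F (tT : letter G * {set letter G}) :=
  [&& side_of tT.1 tT.2, tT.1.1 \notin K, tT.2 \proper P & m \in tT.2].
have [[[s0 S0] /= F0]|noF] := altP (@existsP _ F); last first.
  exists [set m]; split; rewrite ?set11 //.
  - rewrite properEcard sub1set mP cards1 /=.
    by case/and3P: sP.
  - move=> x y; rewrite inE => /eqP-> _ yK uy.
    by rewrite inE uy in yK.
  move=> t T T_of tK TP; rewrite orbC disjoint_sym disjoints1.
  have [mT|//] := boolP (m \in T).
  by case/existsPn/(_ (t, T))/negP: noF; apply/and4P.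
have [[s S] /and4P[/= S_of sK SP mS] Smax] :=
  @exists_maximizer _ F (fun tT => #|tT.2|) _ F0.
have [sS _] := andP S_of; have lks := lkE _ _ S_of sK SP mS.
exists S; split=> //.
  by rewrite -lks => x y xS _; apply: (side_closed sS xS).
move=> t T T_of tK TP; have [sT _] := andP T_of.
have ts : t.1 \notin lk s.1 by rewrite lks.
have st_ : s.1 \notin lk t.1 by rewrite mem_lkC.
have [/partition_of_side[->|TE]|neq] :=
    eqVneq (partition_of t T) (partition_of s S).
- by rewrite subxx.
- have := n_costar _ _ S_of SP; rewrite -TE => /(subsetP (proper_sub TP)).
  by move/negP: nP.
have no : ~~ orthogonal t.1 s.1.
  by apply: contra st_ => /andP[h _]; rewrite inE.
case/or4P: (side_of_nested T_of S_of neq no) => [->|d|d|d].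
- by rewrite orbT.
- rewrite -(costarK sS) (disjoint_sub_costar sT (side_costar sS)) //=.
- have ST : S \subset T.
    rewrite -(costarK sT); apply: disjoint_sub_costar sS (side_costar sT) _ _ => //.
    by rewrite disjoint_sym.
  have /eqP-> : S == T.
    rewrite eqEcard ST; apply: (Smax (t, T)).
    by apply/and4P; split=> //; apply: (subsetP ST).
  by rewrite subxx.
by have := disjointFr d (n_costar _ _ T_of TP); rewrite (n_costar _ _ S_of SP).
Qed.

(** The side R = A + P1 crosses P, which shows that it is new; it is nested with
the other sides because T disjoint from P is handled by the choice of A, and T
inside P by that of P1. *)
Lemma exchange_side :
  exists n R, [/\ principal n.1, GW_side n R, partition_of n R \notin Pi &
    forall t T, side_of t T -> partition_of t T != p ->
      compatible (partition_of n R) (partition_of t T)].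
Proof.
have [n [A [an GA dAP Aprop]]] := enlarged_base.
have [P1 [mP1 P1P P1c P1prop]] := inner_part.
have [pn Kn] := andP an; have nK := above_notin_lk Kn.
have [nA inA Alk Ac] := GW_subsetP _ _ GA.
have [P1sub [z zP zP1]] := properP P1P.
have zA : z \notin A by rewrite (disjointFl dAP).
have mP := side_base sP.
have mA : m \notin A by rewrite (disjointFl dAP).
have inP : inv n \notin P by apply: above_notin_outer.
have nP : n \notin P by apply: above_notin_outer.
pose R := A :|: P1.
have nR : n \in R by rewrite inE nA.
have mR : m \in R by rewrite inE mP1 orbT.
have zR : z \in costar n R.
  by rewrite in_costar inE (negbTE zA) (negbTE zP1) outer_notin_lk.
have inR : inv n \in costar n R.
  rewrite in_costar inE (negbTE inA) lk_irrefl andbT.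
  by apply: contra inP; apply: subsetP.
have sR : GW_side n R.
  apply/and3P; split.
  - apply/GW_subsetP; split=> //.
    + by move: inR; rewrite in_costar => /andP[].
    + by move=> x /setUP[/Alk|/(subsetP P1sub)]//; apply: outer_notin_lk.
    move=> x y /setUP[xA xn yn xy|xP1 xn yn xy]; apply/setUP.
      by left; apply: Ac xy.
    by right; apply: P1c xy => //; [apply: contra xn|apply: contra yn]; apply: subsetP.
  - apply/card_gt1P; exists n, m; split=> //.
    by apply: contraNneq nP => ->.
  apply/card_gt1P; exists z, (inv n); split=> //.
  by apply: contraNneq inP => <-.
exists n, R; split=> //.
  apply/negP => RPi.
  have neq : p != partition_of n R.
    by apply: contra npu => /eqP/partition_of_lk/principal_eq_lk->.
  have R_of : side_of n R by apply/andP.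
  have nPc : n \in costar m P by rewrite in_costar nP nK.
  have inPc : inv n \in costar m P by rewrite in_costar inP nK.
  case/or4P: (side_of_nested P_of R_of neq (not_orthogonal_to_base nK)) => d.
  - by have := disjointFr d mP; rewrite mR.
  - by have := disjointFr d zP; rewrite zR.
  - by have := disjointFr d nPc; rewrite nR.
  by have := disjointFr d inPc; rewrite inR.
move=> t T T_of neqp; have [sT _] := andP T_of.
have [ot|no] := boolP (orthogonal t.1 n.1).
  by rewrite compatible_sym; apply: compatible_orthogonal.
have tK : t.1 \notin K.
  apply: contra no => tK; rewrite /orthogonal.
  have := subsetP Kn _ tK; rewrite mem_lkC inE => -> /=.
  apply/eqP => stE; have : u \in st n.1.
    by rewrite -stE; apply/setU1P; right; rewrite mem_lkC.
  case/setU1P => [un|]; first by case/negP: npu; rewrite un.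
  by rewrite mem_lkC; apply/negP.
rewrite compatible_sym (compatible_nested sT sR) (negbTE no) /=.
have nested_of t' T' : side_of t' T' -> partition_of t' T' = partition_of t T ->
    t'.1 = t.1 -> [disjoint T' & P] || [disjoint T' & costar m P] ->
    [disjoint T' & R] || [disjoint T' & costar n R].
  move=> T'_of pE tE; have [sT' _] := andP T'_of.
  have neqp' : partition_of t' T' != p by rewrite pE.
  have tK' : t'.1 \notin K by rewrite tE.
  case/orP => d.
    have d1 : [disjoint T' & P1] := disjointWr P1sub d.
    have no' : ~~ orthogonal t'.1 n.1 by rewrite tE.
    case/orP: (Aprop _ _ T'_of neqp' tK' no' d) => dA.
      by rewrite disjoints_subset setCU subsetI -!disjoints_subset dA d1.
    apply/orP; right; apply: disjointWr dA; apply/subsetP => x; rewrite !in_costar.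
    by case/andP => xR ->; rewrite andbT; apply: contra xR => xA; apply/setUP; left.
  have T'P : T' \subset P.
    rewrite -(costarK sP).
    apply: disjoint_sub_costar sT' (side_costar sP) _ d.
    by rewrite /= base_notin_lk.
  have T'pP : T' \proper P.
    rewrite properEneq T'P andbT; apply: contra neqp' => /eqP TE.
    have sPt : GW_side t' P by rewrite -TE.
    by rewrite TE /partition_of /costar (same_side_same_lk sP sPt).
  case/orP: (P1prop _ _ T'_of tK' T'pP) => [T'P1|dP1].
    apply/orP; right; rewrite disjoints_subset; apply/subsetP => x /(subsetP T'P1) h.
    by rewrite in_setC in_costar inE h orbT.
  apply/orP; left.
  rewrite disjoints_subset setCU subsetI -!disjoints_subset dP1 andbT.
  by rewrite disjoint_sym; apply: disjointWr dAP.
have := side_of_nested T_of P_of neqp; rewrite /orthogonal adj_sym eq_sym.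
move=> /(_ (not_orthogonal_to_base tK)); rewrite /nested.
have T'_of := side_of_costar T_of; have pE := partition_costar sT.
case/or4P => d.
- by have := nested_of t T T_of erefl erefl; rewrite d => /(_ isT)/orP[]->; rewrite ?orbT.
- by have := nested_of t T T_of erefl erefl; rewrite d orbT => /(_ isT)/orP[]->; rewrite ?orbT.
- by have := nested_of _ _ T'_of pE erefl; rewrite d => /(_ isT)/orP[]->; rewrite ?orbT.
by have := nested_of _ _ T'_of pE erefl; rewrite d orbT => /(_ isT)/orP[]->; rewrite ?orbT.
Qed.

End Exchange.

(** * Replacing all the non-principal partitions *)

Definition principally_based (p : partition3 G) :=
  [exists v in [set v : G | principal v], based_at v p].

Lemma exchange (Pi : {set partition3 G}) p0 :
  compatible_collection Pi -> (forall p, p \in Pi -> exists v, based_at v p) ->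
  p0 \in Pi -> ~~ principally_based p0 ->
  exists p q, [/\ p \in Pi, ~~ principally_based p, q \notin Pi,
    principally_based q & compatible_collection (q |: Pi :\ p)].
Proof.
move=> PiC Pi_based p0Pi bad0.
have [v0 /based_atP[m0 m0v [P0 sP0 p0E]]] := Pi_based _ p0Pi.
have npm0 : ~~ principal m0.1.
  apply: contra bad0 => pm0; apply/exists_inP; exists m0.1; rewrite ?inE //.
  by apply/based_atP; exists m0 => //; exists P0.
have P0_of : side_of Pi m0 P0 by rewrite /side_of sP0 -p0E.
pose F (mP : letter G * {set letter G}) := outer_side Pi mP.1 mP.2.
have [mP0 F0] : exists mP, F mP.
  case: (outer_side_or P0_of npm0) => h; first by exists (m0, P0).
  by exists (inv m0, costar m0 P0).
(* The maximization is lexicographic: the link first, then the side. *)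
have [[m1 P1] F1 lk_max] :=
  @exists_maximizer _ F (fun mP => #|lk mP.1.1|) _ F0.
have F1' : F (m1, P1) && (lk m1.1 == lk m1.1) by rewrite F1 /=.
have [[m P] /andP[/= mPF /eqP mE] card_max] :=
  @exists_maximizer _ (fun mP => F mP && (lk mP.1.1 == lk m1.1))
    (fun mP => #|mP.2|) _ F1'.
have P_max t T : outer_side Pi t T -> lk m.1 \subset lk t.1 ->
    lk t.1 = lk m.1 /\ #|T| <= #|P|.
  move=> Tout mt; have tE : lk t.1 = lk m.1.
    by apply/eqP; rewrite eq_sym eqEcard mt mE; apply: (lk_max (t, T)).
  split=> //; apply: (card_max (t, T)).
  by apply/andP; split; rewrite // tE mE.
have [n [R [pn sR RPi Rcomp]]] := exchange_side PiC mPF P_max.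
have [/andP[sP pPi] npm _] := and3P mPF.
exists (partition_of m P), (partition_of n R); split=> //.
- apply: contra npm => /exists_inP[v]; rewrite inE => pv.
  case/based_atP => m' m'v [P' _ /partition_of_lk/principal_eq_lk->].
  by rewrite m'v.
- apply/exists_inP; exists n.1; rewrite ?inE //.
  by apply/based_atP; exists n => //; exists R.
have Rc q : q \in Pi :\ partition_of m P -> compatible (partition_of n R) q.
  case/setD1P => neq qPi; have [v /based_atP[t _ [T sT qE]]] := Pi_based _ qPi.
  by rewrite qE; apply: Rcomp; rewrite /side_of ?sT -?qE.
apply/forall_inP => q /setU1P q_in; apply/forall_inP => r /setU1P r_in.
apply/implyP => neq; case: q_in r_in neq => [->|q_in] [->|r_in] neq.
- by rewrite eqxx in neq.
- exact: Rc.
- by rewrite compatible_sym; apply: Rc.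
have /setD1P[_ qPi] := q_in; have /setD1P[_ rPi] := r_in.
by have /forall_inP/(_ _ qPi)/forall_inP/(_ _ rPi)/implyP := PiC; apply.
Qed.

Lemma principal_replacement (Pi : {set partition3 G}) :
  compatible_collection Pi -> (forall p, p \in Pi -> exists v, based_at v p) ->
  exists Pi' : {set partition3 G}, [/\ compatible_collection Pi', #|Pi'| = #|Pi| &
    forall p, p \in Pi' -> principally_based p].
Proof.
pose bad (S : {set partition3 G}) := [set p in S | ~~ principally_based p].
have [k] := ubnP #|bad Pi|; elim: k Pi => // k IHk Pi bad_k PiC Pi_based.
have [bad0|[p0]] := set_0Vmem (bad Pi).
  exists Pi; split=> // p pPi; have [//|badp] := boolP (principally_based p).
  by have := in_set0 p; rewrite -bad0 inE pPi badp.
rewrite inE => /andP[p0Pi badp0].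
have [p [q [pPi badp qPi goodq newC]]] := exchange PiC Pi_based p0Pi badp0.
have qD : q \notin Pi :\ p by apply: contra qPi => /setD1P[].
have [||Pi' [C' card' good']] := IHk _ _ newC.
- rewrite -ltnS; apply: leq_trans bad_k; rewrite ltnS; apply: proper_card.
  apply/properP; split.
    apply/subsetP => r; rewrite !inE => /andP[/orP[/eqP->|/andP[_ ->]//]].
    by rewrite goodq.
  exists p; first by rewrite inE pPi.
  rewrite !inE eqxx badp andbT orbF; apply: contraNN badp => /eqP->.
  exact: goodq.
- move=> r /setU1P[->|/setD1P[_ /Pi_based]//].
  by case/exists_inP: goodq => v _; exists v.
exists Pi'; split=> //.
by rewrite card' cardsU1 qD (cardsD1 p Pi) pPi.
Qed.
End OneComponent.
End PrincipalVertices.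

Theorem theorem5p2 (G : sgraph)
  (same_component : forall u : G, ~~ principal u ->
     exists2 C : {set G}, C \in components (lk u) &
       forall m : G, principal m -> maximal_in [set x | lk_le u x] m ->
         m \in C) :
  M [set: G] = M [set v : G | principal v].
Proof.
apply/eqP; rewrite eqn_leq; apply/andP; split.
  apply/bigmax_leqP => Pi /andP[PiC /forall_inP Pi_based].
  have [|Pi' [C' <- good']] := principal_replacement same_component PiC.
    by move=> p /Pi_based /exists_inP[v _]; exists v.
  by apply: leq_bigmax_cond; rewrite C'; apply/forall_inP.
apply/bigmax_leqP => Pi /andP[PiC /forall_inP good].
apply: leq_bigmax_cond; rewrite PiC; apply/forall_inP => p /good.
by case/exists_inP => v _ pv; apply/exists_inP; exists v.
Qed.
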